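(* Let $n\ge 1$ and $0<m\le L$, and put $\rho^*=\frac{\sqrt L-\sqrt m}{\sqrt L+\sqrt m}$. Let $k\ge 1$ and $0\le l\le k$ be integers, and let $\boldsymbol{\alpha}=(\alpha_0,\ldots,\alpha_l)$, $\boldsymbol{\beta}=(\beta_0,\ldots,\beta_{k-1})$, $\boldsymbol{\gamma}=(\gamma_0,\ldots,\gamma_{k-l})$ be any collections of real parameters such that $$\sum_{j=0}^l\alpha_j\neq 0,\qquad \sum_{\nu=0}^{k-l}\gamma_\nu=1 .$$ Let $\mathcal{I}$ denote the iterative process $$x_{t+1}=x_t+\sum_{j=0}^{k-1}\beta_j(x_{t-j}-x_{t-j-1})-\sum_{j=0}^{l}\alpha_j\nabla f(y_{t-j}),\qquad y_t=\sum_{\nu=0}^{k-l}\gamma_\nu x_{t-\nu},\qquad t=0,1,\ldots,$$ applied to $f\in\mathcal{Q}^n_{m,L}$, and suppose that $\mathcal{I}$ asymptotically converges for all $f\in\mathcal{Q}^n_{m,L}$ (that is, for every such $f$ and all initial values $x_{-k},\ldots,x_0\in\mathbf{R}^n$, $x_t\to x^*$ as $t\to\infty$, where $x^*$ is the minimizer of $f$). Then $$\sup_{f\in\mathcal{Q}^n_{m,L}} r_{\mathcal{I}}=\sup_{\Delta:\ mI\le\Delta\le LI}\rho(\bar A)\ \ge\ \rho^*,$$ where $r_{\mathcal{I}}$ is the $R$-factor of $\mathcal{I}$ at $x^*$ and $\bar A=\bar A(\Delta)$ is the $(k+1)n\times(k+1)n$ matrix defined in the context.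
   Context: $\mathcal{Q}^n_{m,L}$ is the set of quadratic functions $f:\mathbf{R}^n\to\mathbf{R}$, $f(x)=\frac12(x-x^* )^T\Delta(x-x^* )+f_0$, with $x^*\in\mathbf{R}^n$, $f_0\in\mathbf{R}$, and $\Delta$ a real symmetric $n\times n$ matrix with $mI\le\Delta\le LI$ (in the positive semidefinite order). The supremum over $\Delta$ is over all such real symmetric matrices. In the iteration, the indices $j+\nu$ do not exceed $k$, so $x_{t+1}$ is determined by $x_{t-k},\ldots,x_t$; for $t\ge 0$, $y_{t-j}$ stands for $\sum_{\nu=0}^{k-l}\gamma_\nu x_{t-j-\nu}$. For a sequence $\{x_t\}$ converging to $x^*$, its root-convergence factor ($R$-factor) is $r_{\{x_t\}}=\limsup_{t\to\infty}\|x_t-x^*\|^{1/t}$. For an iterative process $\mathcal{I}$ with limit point $x^*$, let $\mathcal{C}(\mathcal{I},x^* )$ be the set of all sequences generated by $\mathcal{I}$ (over all initial values) which converge to $x^*$; the $R$-factor of $\mathcal{I}$ at $x^*$ is $r_{\mathcal{I}}=\sup\{r_{\{x_t\}}:\{x_t\}\in\mathcal{C}(\mathcal{I},x^* )\}$. $\rho(M)$ denotes the spectral radius of a matrix $M$, $I_n$ the $n\times n$ identity matrix, and $\otimes$ the Kronecker product. The matrix $\bar A$ is $$\bar A=A_0\otimes I_n-(B_0\otimes\Delta)C,$$ where: - $A_0\in\mathbf{R}^{(k+1)\times(k+1)}$ has first $k$ rows $[\mathbf{0}\ |\ I_k]$ (a zero column followed by the $k\times k$ identity) and last row $[-\beta_{k-1},\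 \beta_{k-1}-\beta_{k-2},\ \beta_{k-2}-\beta_{k-3},\ \ldots,\ \beta_1-\beta_0,\ 1+\beta_0]$ (for $k=1$ the last row is $[-\beta_0,\ 1+\beta_0]$); - $B_0\in\mathbf{R}^{(k+1)\times(l+1)}$ has first $k$ rows zero and last row $[\alpha_l,\alpha_{l-1},\ldots,\alpha_0]$; - $C=[C_l^T\ \cdots\ C_0^T]^T\in\mathbf{R}^{(l+1)n\times(k+1)n}$ with $C_j=C_j^0\otimes I_n$ and $C_j^0\in\mathbf{R}^{1\times(k+1)}$ the row consisting of $l-j$ zeros, followed by $\gamma_{k-l},\gamma_{k-l-1},\ldots,\gamma_0$, followed by $j$ zeros, for $j=0,\ldots,l$. With $X_t=[x_{t-k}^T\ \cdots\ x_t^T]^T$ and $X^*=[1\ \cdots\ 1]^T\otimes x^*$ ($k+1$ ones), the iteration for $f\in\mathcal{Q}^n_{m,L}$ with Hessian $\Delta$ reads $X_{t+1}-X^*=\bar A(X_t-X^* )$. *)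

(* Defs.v *)
From HB Require Import structures.
From mathcomp Require Import all_boot all_order all_algebra.
From mathcomp Require Import all_classical all_reals all_analysis.
From mathcomp Require Import complex mxtens.

Set Implicit Arguments.
Unset Strict Implicit.
Unset Printing Implicit Defensive.
Import Order.TTheory GRing.Theory Num.Theory.
Import numFieldNormedType.Exports.

Local Open Scope classical_set_scope.
Local Open Scope ring_scope.

Section EuclideanSpace.
Context {R : realType} {n : nat}.

Definition enorm (x : 'cV[R]_n) : R := Num.sqrt (\sum_i x i ord0 ^+ 2).

Definition grad (f : 'cV[R]_n -> R) (x : 'cV[R]_n) : 'cV[R]_n :=
  \col_i 'D_(delta_mx i ord0) f x.

Definition minimizer (f : 'cV[R]_n -> R) (xs : 'cV[R]_n) : Prop :=
  forall x, f xs <= f x.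

Definition psd (M : 'M[R]_n) : Prop :=
  forall v : 'cV[R]_n, 0 <= (v^T *m M *m v) ord0 ord0.

(* Symmetric matrices with mI <= Delta <= LI in the semidefinite order. *)
Definition hessians (m L : R) : set 'M[R]_n :=
  [set Delta | [/\ Delta^T = Delta, psd (Delta - m%:M) & psd (L%:M - Delta)]].

Definition quadratics (m L : R) : set ('cV[R]_n -> R) :=
  [set f | exists (Delta : 'M[R]_n) (xs : 'cV[R]_n) (f0 : R),
     hessians m L Delta /\
     f = fun x : 'cV[R]_n => 2^-1 * ((x - xs)^T *m Delta *m (x - xs)) ord0 ord0 + f0].

(* Over the complex eigenvalues of a real matrix. The real supremum is a
   genuine maximum unless n = 0, when there are no eigenvalues. *)
Definition spectral_radius (M : 'M[R]_n) : R :=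
  sup [set complex.Re `|z| | z in
    [set z : complex R | eigenvalue (map_mx (real_complex R) M) z]].

Definition Rfactor_seq (x : int -> 'cV[R]_n) (xs : 'cV[R]_n) : \bar R :=
  limn_esup (fun t : nat => (enorm (x t%:Z - xs) `^ (t%:R)^-1)%:E).

Definition converges_to (x : int -> 'cV[R]_n) (xs : 'cV[R]_n) : Prop :=
  (fun t : nat => x t%:Z) @ \oo --> xs.

End EuclideanSpace.

(* The parameters are tuples, so alpha`_j is alpha_j for 0 <= j <= l, beta`_j is
   beta_j for 0 <= j < k, and gamma`_nu is gamma_nu for 0 <= nu <= k - l. *)
Section Method.
Context {R : realType} {k l : nat}.
Variables (alpha : l.+1.-tuple R) (beta : k.-tuple R)
          (gamma : (k - l).+1.-tuple R).

(* A trajectory is indexed by int, with initial values x_{-k}, ..., x_0; its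
   entries at indices below -k are unconstrained and never used. *)
Definition generated {n : nat} (f : 'cV[R]_n -> R)
    (x : int -> 'cV[R]_n) : Prop :=
  let y (s : int) := \sum_(nu < (k - l).+1) gamma`_nu *: x (s - nu%:Z) in
  forall t : nat,
    x (t%:Z + 1) = x t%:Z
      + \sum_(j < k) beta`_j *: (x (t%:Z - j%:Z) - x (t%:Z - j%:Z - 1))
      - \sum_(j < l.+1) alpha`_j *: grad f (y (t%:Z - j%:Z)).

Definition asymptotically_converges {n : nat} (f : 'cV[R]_n -> R) : Prop :=
  forall xs, minimizer f xs -> forall x, generated f x -> converges_to x xs.

Definition Rfactor {n : nat} (f : 'cV[R]_n -> R) (xs : 'cV[R]_n) : \bar R :=
  ereal_sup [set Rfactor_seq x xs | x in
    [set x | generated f x /\ converges_to x xs]].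

Definition A0 : 'M[R]_k.+1 :=
  \matrix_(i, j)
    if (i < k)%N then (j == i.+1 :> nat)%:R
    else if j == 0 :> nat then - beta`_(k - 1)
    else if j == k :> nat then 1 + beta`_0
    else beta`_(k - j) - beta`_(k - j - 1).

Definition B0 : 'M[R]_(k.+1, l.+1) :=
  \matrix_(i, j) if (i < k)%N then 0 else alpha`_(l - j).

(* l - j zeros, then gamma_{k-l}, ..., gamma_0, then j zeros. *)
Definition C0row (j : nat) : 'rV[R]_k.+1 :=
  \row_i if (l - j <= i <= k - j)%N then gamma`_(k - j - i) else 0.

Definition Cblock (n j : nat) : 'M[R]_(1 * n, k.+1 * n) := C0row j *t 1%:M.

(* The vertical stack of the blocks C_l, ..., C_0: row r * n + s, with s < n,
   is row s of the block C_{l-r}. *)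
Definition Cmx (n : nat) : 'M[R]_(l.+1 * n, k.+1 * n) :=
  \matrix_(p, q) Cblock n (l - (mxtens_unindex p).1)
                   (mxtens_index (ord0, (mxtens_unindex p).2)) q.

Definition Abar {n : nat} (Delta : 'M[R]_n) : 'M[R]_(k.+1 * n) :=
  A0 *t 1%:M - (B0 *t Delta) *m Cmx n.

End Method.

(* Main.v *)
(* The error state [X_t - X^*] evolves by powers of [Abar], and [|Abar^t| <= K r^t]
   for every [r > rho(Abar)], which bounds the R-factor from above.  Conversely, a
   complex eigenvector for the eigenvalue [z] yields two real trajectories, from
   its real and imaginary parts, one of which has error at least [c |z|^t] at each
   time [t].

   For the lower bound take [Delta = d I].  Then [Abar(d) = P - d E] with
   [P 1 = 1], so an entry of [Abar(d)^t 1] is a polynomial [p_t(d)] of degree at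
   most [t] with [p_t(0) = 1].  If [rho(Abar(d)) <= r0 < r] for all [d] in
   [[m, L]], then [|p_t| <= K r^t] on [[m, L]] with [K] independent of [d] and
   [t], while Chebyshev's inequality bounds the maximum of [|p_t|] on [[m, L]]
   below by a constant times [rho_star^t]; hence [rho_star <= r]. *)
Require Import Defs.
From HB Require Import structures.
From mathcomp Require Import all_boot all_order all_algebra.
From mathcomp Require Import all_classical all_reals all_analysis.
From mathcomp Require Import complex mxtens.
From mathcomp Require Import cyclic separable cyclotomic ring lra zify.

Set Implicit Arguments.
Unset Strict Implicit.
Unset Printing Implicit Defensive.
Import Order.TTheory GRing.Theory Num.Theory.
Import numFieldNormedType.Exports.

Local Open Scope classical_set_scope.
Local Open Scope ring_scope.
Import ComplexField.Normc.

(** * Spectral radius and growth of matrix powers *)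

Section Norm1.
Variable R : realType.
Local Notation C := (complex R).

Lemma normc_ge0 (z : C) : 0 <= normc z.
Proof. by case: z => a b; rewrite sqrtr_ge0. Qed.

Lemma normc_sum (I : finType) (F : I -> C) :
  normc (\sum_i F i) <= \sum_i normc (F i).
Proof.
elim/big_ind2: _ => [|x a y b xa yb|//]; first by rewrite normc0.
exact: le_trans (le_normcD _ _) (lerD xa yb).
Qed.

Definition norm1 n (v : 'cV[C]_n) : R := \sum_i normc (v i ord0).

Lemma norm1_ge0 n (v : 'cV[C]_n) : 0 <= norm1 v.
Proof. by apply: sumr_ge0 => i _; apply: normc_ge0. Qed.

Lemma norm1_eq0 n (v : 'cV[C]_n) : norm1 v = 0 -> v = 0.
Proof.
move=> /eqP; rewrite psumr_eq0 => [/allP v0|i _]; last exact: normc_ge0.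
apply/matrixP => i j; rewrite ord1 mxE; apply: eq0_normc.
by apply/eqP; apply: v0; rewrite mem_index_enum.
Qed.

Lemma norm1D n (u v : 'cV[C]_n) : norm1 (u + v) <= norm1 u + norm1 v.
Proof.
by rewrite -big_split /= ler_sum // => i _; rewrite mxE; exact: le_normcD.
Qed.

Lemma norm1Z n (z : C) (v : 'cV[C]_n) : norm1 (z *: v) = normc z * norm1 v.
Proof. by rewrite mulr_sumr; apply: eq_bigr => i _; rewrite mxE normcM. Qed.

Lemma norm1_mul n (A : 'M[C]_n) (v : 'cV[C]_n) :
  norm1 (A *m v) <= (\sum_i \sum_j normc (A i j)) * norm1 v.
Proof.
rewrite mulr_suml; apply: ler_sum => i _; rewrite mxE.
apply: le_trans (normc_sum _) _; rewrite mulr_suml; apply: ler_sum => j _.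
rewrite normcM; apply: ler_wpM2l; first exact: normc_ge0.
rewrite /norm1 (bigD1 j) //= lerDl sumr_ge0 // => i0 _; exact: normc_ge0.
Qed.

Lemma char_poly_split n (A : 'M[C]_n) :
  {s : seq C | char_poly A = \prod_(z <- s) ('X - z%:P) & size s = n}.
Proof.
have [s Ds] := closed_field_poly_normal (char_poly A).
rewrite (monicP (char_poly_monic A)) scale1r in Ds; exists s => //.
by apply: succn_inj; rewrite -(size_char_poly A) Ds size_prod_XsubC.
Qed.

(** Cayley-Hamilton in factored form: applying the factors [A - z] one at a time lets an induction
    split off a single root. *)
Lemma Cayley_Hamilton_mul n (A : 'M[C]_n) (s : seq C) (v : 'cV[C]_n) :
  char_poly A = \prod_(z <- s) ('X - z%:P) ->
  foldr (fun z w => A *m w - z *: w) v s = 0.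
Proof.
case: n A v => [|n] A v Ds; first by apply/matrixP => -[].
suff -> : forall s0 : seq C, foldr (fun z w => A *m w - z *: w) v s0
    = horner_mx A (\prod_(z <- s0) ('X - z%:P)) *m v.
  by rewrite -Ds Cayley_Hamilton mul0mx.
elim=> [|z s0 IH] /=; first by rewrite big_nil rmorph1 mul1mx.
rewrite big_cons rmorphM rmorphB /= horner_mx_X horner_mx_C IH.
by rewrite -mulmxE -mulmxA mulmxBl mul_scalar_mx.
Qed.

(* Depends on [A] only through [B], [r0] and the dimension [d], so that the bound is
   uniform over a bounded family of matrices. *)
Definition power_const (B r0 r : R) (d : nat) : R :=
  iter d (fun K => 1 + K * (B + r0) / (r - r0)) 0.

Lemma power_const_ge0 B r0 r d :
  0 <= B -> 0 <= r0 -> r0 < r -> 0 <= power_const B r0 r d.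
Proof.
move=> B0 r00 r0r; elim: d => //= d IH.
by rewrite addr_ge0 // divr_ge0 ?subr_ge0 ?(ltW r0r) // mulr_ge0 // addr_ge0.
Qed.

(** Induction on the number of roots: [w = (A - z) v] is annihilated by one factor fewer, and
    [A^(u+1) v = A^u w + z A^u v] turns its bound into a scalar recurrence for [v]. *)
Lemma iter_mulmx_bound n (A : 'M[C]_n) (B r0 r : R) (s : seq C) :
  \sum_i \sum_j normc (A i j) <= B -> 0 <= r0 -> r0 < r ->
  (forall z, z \in s -> normc z <= r0) ->
  forall v t, foldr (fun z w => A *m w - z *: w) v s = 0 ->
  norm1 (iter t (mulmx A) v) <= power_const B r0 r (size s) * r ^+ t * norm1 v.
Proof.
move=> AB r00 r0r; have B0 : 0 <= B.
  by apply: le_trans AB; do 2![apply: sumr_ge0 => ? _]; exact: normc_ge0.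
have r_ge0 : 0 <= r by lra.
elim/last_ind: s => [|s z IH] sr0 v t /=.
  move=> ->; suff -> : iter t (mulmx A) 0 = 0 :> 'cV_n.
    by rewrite /norm1 big1 ?mulr0 // => i _; rewrite mxE normc0.
  by elim: t => //= t ->; rewrite mulmx0.
rewrite foldr_rcons size_rcons /=.
set w := _ - _ => s0; set K := power_const _ _ _ _ in IH *.
have zr : normc z <= r0 by apply: sr0; rewrite mem_rcons inE eqxx.
have K0 : 0 <= K by apply: power_const_ge0.
have v0 := norm1_ge0 v.
have wv : norm1 w <= (B + r0) * norm1 v.
  rewrite mulrDl (le_trans (norm1D _ _)) // lerD //.
    by rewrite (le_trans (norm1_mul _ _)) // ler_wpM2r.
  by rewrite -scaleNr norm1Z normcN ler_wpM2r.
have wt u : norm1 (iter u (mulmx A) w) <= K * r ^+ u * ((B + r0) * norm1 v).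
  apply: le_trans (IH _ _ _ s0) _.
    by move=> x xs; apply: sr0; rewrite mem_rcons inE xs orbT.
  by rewrite ler_wpM2l // mulr_ge0 // exprn_ge0.
have Av u : iter u.+1 (mulmx A) v = iter u (mulmx A) w + z *: iter u (mulmx A) v.
  rewrite iterSr /w; elim: u => [|u IHu] /=; first by rewrite subrK.
  by rewrite IHu mulmxDr -scalemxAr.
(* Hence [r K' >= r0 K' + K (B + r0)], which is what the recurrence needs to preserve the bound
   [K' r^t]. *)
set K' := 1 + _; have K'E : K' * (r - r0) = (r - r0) + K * (B + r0).
  by rewrite /K'; field; rewrite subr_eq0 gt_eqF.
have K'0 : 0 <= K * (B + r0) by rewrite mulr_ge0 // addr_ge0.
have K'1 : 1 <= K'.
  by rewrite /K' lerDl divr_ge0 // subr_ge0 ltW.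
elim: t => [|t IHt]; first by rewrite /= expr0 mulr1 ler_peMl.
rewrite Av (le_trans (norm1D _ _)) // norm1Z.
apply: le_trans (lerD (wt t) (ler_pM (normc_ge0 z) (norm1_ge0 _) zr IHt)) _.
rewrite -subr_ge0 exprS.
have -> : K' * (r * r ^+ t) * norm1 v
    - (K * r ^+ t * ((B + r0) * norm1 v) + r0 * (K' * r ^+ t * norm1 v))
  = r ^+ t * norm1 v * (K' * (r - r0) - K * (B + r0)) by ring.
rewrite K'E addrK !mulr_ge0 ?exprn_ge0 // subr_ge0 ltW //.
Qed.

Lemma power_bound n (A : 'M[C]_n) (B r0 r : R) v t :
  \sum_i \sum_j normc (A i j) <= B -> 0 <= r0 -> r0 < r ->
  (forall z, eigenvalue A z -> normc z <= r0) ->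
  norm1 (iter t (mulmx A) v) <= power_const B r0 r n * r ^+ t * norm1 v.
Proof.
move=> AB r00 r0r Ar0; have [s Ds sn] := char_poly_split A.
rewrite -[X in power_const _ _ _ X]sn.
apply: iter_mulmx_bound => //; last exact: Cayley_Hamilton_mul.
by move=> z zs; apply: Ar0; rewrite eigenvalue_root_char Ds root_prod_XsubC.
Qed.

Local Notation toC := (map_mx (real_complex R)).

(** The set of moduli is bounded: the moduli of all roots of the characteristic polynomial add up to
    an upper bound. *)
Lemma eigenvalue_normc_sup n (A : 'M[R]_n) z :
  eigenvalue (toC A) z -> normc z <= spectral_radius A.
Proof.
move=> Az; apply: ub_le_sup; last by exists z.
have [s Ds _] := char_poly_split (toC A).
exists (\sum_(x <- s) normc x) => _ [x Ax <-].
have xs : x \in s by rewrite -root_prod_XsubC -Ds -eigenvalue_root_char.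
rewrite (big_rem x) //= lerDl; apply: sumr_ge0 => i _; exact: normc_ge0.
Qed.

Lemma eigenvalue_exists n (A : 'M[R]_n) :
  (0 < n)%N -> exists z, eigenvalue (toC A) z.
Proof.
move=> n0; have [[|z s] Ds sn] := char_poly_split (toC A).
  by rewrite -sn in n0.
by exists z; rewrite eigenvalue_root_char Ds root_prod_XsubC mem_head.
Qed.

Lemma spectral_radius_ge0 n (A : 'M[R]_n) : (0 < n)%N -> 0 <= spectral_radius A.
Proof.
move=> /eigenvalue_exists -/(_ A)[z /eigenvalue_normc_sup].
by apply: le_trans; exact: normc_ge0.
Qed.

Lemma spectral_radius_le n (A : 'M[R]_n) r : (0 < n)%N ->
  (forall z, eigenvalue (toC A) z -> normc z <= r) -> spectral_radius A <= r.
Proof.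
move=> n0 Ar; have [z Az] := eigenvalue_exists A n0.
by apply: ge_sup; [exists (normc z); exists z|move=> _ [x Ax <-]; exact: Ar].
Qed.

Lemma char_poly_tr n (A : 'M[C]_n) : char_poly A^T = char_poly A.
Proof.
rewrite /char_poly -[RHS]det_tr; congr (\det _); apply/matrixP => i j.
by rewrite !mxE eq_sym.
Qed.

(** [eigenvalue] speaks of row vectors, while the iteration acts on columns; transposition preserves
    the characteristic polynomial. *)
Lemma eigenvalue_col n (A : 'M[C]_n) z :
  eigenvalue A z -> exists2 v : 'cV_n, v != 0 & A *m v = z *: v.
Proof.
rewrite eigenvalue_root_char -char_poly_tr -eigenvalue_root_char.
move=> /eigenvalueP[v vA v0]; exists v^T; first by rewrite trmx_eq0.
by rewrite -[A]trmxK -trmx_mul vA linearZ.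
Qed.

Lemma spectral_power_bound n (A : 'M[R]_n) (B r0 r : R) (v : 'cV[R]_n) t :
  \sum_i \sum_j `|A i j| <= B -> 0 <= r0 -> spectral_radius A <= r0 -> r0 < r ->
  \sum_i `|iter t (mulmx A) v i ord0|
    <= power_const B r0 r n * r ^+ t * \sum_i `|v i ord0|.
Proof.
have nR x : normc (x%:C)%C = `|x| :> R by rewrite /= expr0n addr0 sqrtr_sqr.
have n1 (u : 'cV[R]_n) : norm1 (toC u) = \sum_i `|u i ord0|.
  by apply: eq_bigr => i _; rewrite mxE nR.
move=> AB r00 Ar r0r; rewrite -!n1.
have -> : toC (iter t (mulmx A) v) = iter t (mulmx (toC A)) (toC v).
  by elim: t => //= t <-; rewrite map_mxM.
apply: power_bound => //.
  apply: le_trans AB; rewrite le_eqVlt; apply/orP; left; apply/eqP.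
  by do 2!apply: eq_bigr => ? _; rewrite mxE nR.
by move=> z /eigenvalue_normc_sup/le_trans; apply.
Qed.

End Norm1.

(** Constants cannot compensate a gap between exponential rates: if [r < a], then [K (r / a)^t]
    tends to 0 and falls below [c]. *)
Lemma le_geometric (R : realType) (a r c K : R) (N : nat) :
  0 <= a -> 0 <= r -> 0 < c ->
  (forall t, (N <= t)%N -> c * a ^+ t <= K * r ^+ t) -> a <= r.
Proof.
move=> a0 r0 c0 H; rewrite leNgt; apply/negP => ra.
have a_gt0 : 0 < a by apply: le_lt_trans ra.
have : (fun t => K * (r / a) ^+ t) @ \oo --> K * 0.
  apply: cvgM; first exact: cvg_cst.
  apply: cvg_expr.
  by rewrite ger0_norm ?divr_ge0 // ltr_pdivrMr // mul1r.
rewrite mulr0 => /cvgr_lt /(_ c c0) [M _ HM].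
have := HM (maxn N M) (leq_maxr _ _); rewrite /= ltNge => /negP; apply.
by rewrite expr_div_n mulrA ler_pdivlMr ?exprn_gt0 // H // leq_maxl.
Qed.

(** * A Chebyshev-type bound for polynomials, applied to affine matrix pencils *)

Section Chebyshev.
Variable R : realType.
Local Notation C := (complex R).
Local Notation toC := (real_complex R).

Lemma normcX (z : C) n : normc (z ^+ n) = normc z ^+ n.
Proof. by elim: n => [|n IH]; rewrite ?normc1 // !exprS normcM IH. Qed.

Lemma normc_real (x : R) : normc (toC x) = `|x|.
Proof. by rewrite /= expr0n addr0 sqrtr_sqr. Qed.

Lemma prim_root_exists n : (0 < n)%N -> exists z : C, n.-primitive_root z.
Proof.
move=> n0; have [s] := closed_field_poly_normal ('X^n - 1 : {poly C}).
rewrite (monicP (monicXnsubC _ n0)) scale1r => Ds.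
have /hasP[z _ zn] : has n.-primitive_root s; last by exists z.
apply: has_prim_root => //.
- by apply/allP => z; rewrite -root_prod_XsubC -Ds.
- by rewrite -separable_prod_XsubC -Ds separable_Xn_sub_1 // pnatr_eq0 -lt0n.
- by rewrite -ltnS -(size_prod_XsubC s id) -Ds size_XnsubC.
Qed.

(** Orthogonality of characters: unless [w^i = 1], the nonzero factor [w^i - 1] annihilates the
    geometric sum. *)
Lemma sum_prim_root (n : nat) (w : C) (i : nat) : n.-primitive_root w ->
  \sum_(k < n) (w ^+ i) ^+ k = (n %| i)%:R * n%:R.
Proof.
move=> wn; have [ni|ni] := boolP (n %| i)%N.
  rewrite -[w ^+ i](prim_expr_mod wn) (eqP ni) expr0 mul1r.
  by under eq_bigr do rewrite expr1n; rewrite sumr_const card_ord.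
apply/eqP; rewrite mul0r; have /eqP : (w ^+ i - 1) * \sum_(k < n) (w ^+ i) ^+ k = 0.
  by rewrite -subrX1 exprAC (prim_expr_order wn) expr1n subrr.
by rewrite mulf_eq0 subr_eq0 -(prim_order_dvd wn) (negbTE ni).
Qed.

(* Cauchy's estimate, with the integral over the unit circle replaced by an
   average over roots of unity. *)
Lemma normc_coef_le (G : {poly C}) (M : R) (j : nat) :
  (forall w, normc w = 1 -> normc G.[w] <= M) -> normc G`_j <= M.
Proof.
move=> GM; have M0 : 0 <= M by apply: le_trans (normc_ge0 _) (GM _ (normc1 _)).
have [Gj|jG] := leqP (size G) j; first by rewrite nth_default // normc0.
set N := size G in jG; have N0 : (0 < N)%N by apply: leq_ltn_trans jG.
have [w wN] := prim_root_exists N0.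
have w1 : normc w = 1.
  apply/eqP; rewrite -(@pexpr_eq1 _ _ N) ?normc_ge0 //.
  by rewrite -normcX (prim_expr_order wN) normc1.
have E : \sum_(i < N) G.[w ^+ i] * (w ^+ (N - j)) ^+ i = G`_j * N%:R.
  under eq_bigr do rewrite horner_coef mulr_suml.
  rewrite exchange_big (bigD1 (Ordinal jG)) //= [X in _ + X]big1 ?addr0.
    transitivity (G`_j * \sum_(i < N) (w ^+ N) ^+ i).
      rewrite mulr_sumr; apply: eq_bigr => i _.
      by rewrite -mulrA [w ^+ i ^+ j]exprAC -exprMn -exprD subnKC // ltnW.
    by rewrite sum_prim_root // dvdnn mul1r.
  move=> k kj; transitivity (G`_k * \sum_(i < N) (w ^+ (k + (N - j))) ^+ i).
    rewrite mulr_sumr; apply: eq_bigr => i _.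
    by rewrite -mulrA [w ^+ i ^+ k]exprAC -exprMn -exprD.
  rewrite sum_prim_root // (_ : (_ %| _)%N = false) ?mul0r ?mulr0 //.
  (* Here [0 < k + (N - j) < 2 N], so divisibility by [N] forces [k = j]: with [N = size G] there is
     no aliasing. *)
  apply: contraNF kj => /dvdnP[q Hq]; apply/eqP/val_inj => /=.
  by have := ltn_ord k; case: q Hq => [|[|q]]; rewrite ?mulSn; lia.
have N0R : 0 < N%:R :> R by rewrite ltr0n.
rewrite -(ler_pM2r N0R).
have -> : normc G`_j * N%:R = normc (G`_j * N%:R).
  by rewrite normcM -[N%:R : C](rmorph_nat toC) normc_real ger0_norm ?ler0n.
rewrite -E; apply: le_trans (normc_sum _) _.
apply: (@le_trans _ _ (\sum_(i < N) M)); last first.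
  by rewrite sumr_const card_ord mulr_natr.
apply: ler_sum => i _; rewrite normcM !normcX w1 !expr1n mulr1 GM //.
by rewrite normcX w1 expr1n.
Qed.

Lemma sum_geo_le (x : R) n : 0 <= x < 1 -> \sum_(i < n) x ^+ i <= (1 - x)^-1.
Proof.
move=> /andP[x0 x1]; have x1' : 0 < 1 - x by rewrite subr_gt0.
rewrite -(ler_pM2l x1') divff ?gt_eqF //.
have -> : (1 - x) * \sum_(i < n) x ^+ i = 1 - x ^+ n.
  by rewrite -[in LHS]opprB mulNr -subrX1 opprB.
by rewrite lerBlDr lerDl exprn_ge0.
Qed.

(* The Joukowski map d(w) = (L + m)/2 - (L - m)/4 * (w + 1/w) sends the unit
   circle onto [m, L] and rho to 0, and G(w) = w^t p(d(w)) is a polynomial. *)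
Lemma poly_at0_le (p : {poly R}) (t : nat) (m L M : R) :
  let rho := (Num.sqrt L - Num.sqrt m) / (Num.sqrt L + Num.sqrt m) in
  0 < m -> m <= L -> (size p <= t.+1)%N ->
  (forall d, m <= d <= L -> `|p.[d]| <= M) ->
  `|p.[0]| * rho ^+ t <= M / (1 - rho).
Proof.
move=> rho m0 mL pt pM.
have L0 : 0 < L by apply: lt_le_trans mL.
have s0 : 0 < Num.sqrt m by rewrite sqrtr_gt0.
have sm : Num.sqrt m <= Num.sqrt L by rewrite ler_sqrt // ltW.
have Sp : 0 < Num.sqrt L + Num.sqrt m by lra.
have rho01 : 0 <= rho < 1.
  by rewrite divr_ge0 ?subr_ge0 ?(ltW Sp) //= ltr_pdivrMr //; lra.
pose a := (L + m) / 2; pose b := (L - m) / 4.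
(* This is [d(rho) = 0] with the denominator cleared, so that it also covers [rho = 0], the case
   [m = L]. *)
have arho : a * rho = b * (rho ^+ 2 + 1).
  have -> : a = (Num.sqrt L ^+ 2 + Num.sqrt m ^+ 2) / 2.
    by rewrite !sqr_sqrtr ?ltW.
  have -> : b = (Num.sqrt L ^+ 2 - Num.sqrt m ^+ 2) / 4.
    by rewrite !sqr_sqrtr ?ltW.
  by rewrite /rho; field; rewrite gt_eqF.
clearbody rho.
(* [D(w) = w d(w)]; the factor [w^t] clears all poles of [p(d(w))] because [p] has degree at most
   [t]. *)
pose D : {poly C} := toC a *: 'X - toC b *: ('X^2 + 1).
pose G : {poly C} := \sum_(i < t.+1) toC p`_i *: (D ^+ i * 'X^(t - i)).
have GE w : w != 0 -> G.[w] = w ^+ t * (map_poly toC p).[D.[w] / w].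
  move=> w0; rewrite (@horner_coef_wide _ t.+1 (map_poly _ _)) ?size_map_poly //.
  rewrite mulr_sumr horner_sum; apply: eq_bigr => i _.
  rewrite hornerZ hornerM horner_exp hornerXn coef_map expr_div_n.
  have it : (i <= t)%N by rewrite -ltnS.
  have -> : w ^+ t = w ^+ (t - i) * w ^+ i by rewrite -exprD subnK.
  by field; rewrite expf_neq0.
have GM j : normc G`_j <= M.
  apply: normc_coef_le => w w1; have w0 : w != 0.
    by apply: contra_eq_neq w1 => ->; rewrite normc0 eq_sym oner_neq0.
  rewrite GE // normcM normcX w1 expr1n mul1r.
  suff [d dmL ->] : exists2 d : R, m <= d <= L & D.[w] / w = toC d.
    by rewrite horner_map normc_real; exact: pM.
  case: w w1 w0 => x y /=; rewrite /D => w1 w0.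
  have xy : x ^+ 2 + y ^+ 2 = 1.
    by rewrite -[LHS]sqr_sqrtr ?addr_ge0 ?sqr_ge0 // w1 expr1n.
  (* On the unit circle [w + 1/w] is twice the real part [x] of [w]. *)
  exists (a - 2 * b * x).
    have x1 : -1 <= x <= 1 by have := sqr_ge0 y; nra.
    rewrite /a /b; nra.
  apply: (mulIf w0); rewrite mulfVK // !hornerE.
  apply/eqP; rewrite eq_complex /=; apply/andP; split; apply/eqP => /=.
    have -> : y * y = 1 - x * x by rewrite -xy; ring.
    by rewrite /b; field.
  by rewrite /b; field.
(* Since [D] vanishes at [rho], only the term of index 0 survives. *)
have Grho : G.[toC rho] = toC (p.[0] * rho ^+ t).
  rewrite horner_sum big_ord_recl /= big1 => [|i _].
    by rewrite addr0 expr0 mul1r subn0 hornerZ hornerXn horner_coef0 rmorphM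
      rmorphXn.
  rewrite hornerZ hornerM horner_exp.
  have -> : D.[toC rho] = 0.
    rewrite !hornerE -rmorphXn -(rmorph1 toC) -rmorphD -!rmorphM -rmorphB.
    by rewrite arho subrr.
  by rewrite expr0n /= mul0r mulr0.
have -> : `|p.[0]| * rho ^+ t = normc G.[toC rho].
  by rewrite Grho normc_real normrM [`|_ ^+ t|]ger0_norm // exprn_ge0 //; lra.
have M0 : 0 <= M by apply: le_trans (GM 0%N); exact: normc_ge0.
rewrite horner_coef; apply: le_trans (normc_sum _) _.
apply: (@le_trans _ _ (M * \sum_(i < size G) rho ^+ i)).
  rewrite mulr_sumr; apply: ler_sum => i _.
  rewrite normcM normcX normc_real [`|rho|]ger0_norm; last by lra.
  by rewrite ler_wpM2r // exprn_ge0 //; lra.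
by rewrite ler_wpM2l // sum_geo_le.
Qed.

(** Each multiplication by [P - d *: E] raises the degree in [d] by at most one, and at [d = 0] it
    leaves [v] fixed. *)
Lemma affine_pencil_poly n (P E : 'M[R]_n) (v : 'cV[R]_n) t (i : 'I_n) :
  P *m v = v ->
  exists p : {poly R}, [/\ (size p <= t.+1)%N, p.[0] = v i ord0
    & forall d, p.[d] = iter t (mulmx (P - d *: E)) v i ord0].
Proof.
move=> Pv; elim: t i => [|t IH] i.
  exists (v i ord0)%:P; by split=> [||d]; rewrite ?hornerC // size_polyC; case: eqP.
have [/= q Hq] := choice IH.
exists (\sum_j P i j *: q j - 'X * \sum_j E i j *: q j); split.
- apply: leq_trans (size_polyD _ _) _; rewrite size_polyN geq_max.
  have qs (A : 'M[R]_n) : (size (\sum_j A i j *: q j)%R <= t.+1)%N.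
    apply: leq_trans (size_sum _ _ _) _; apply/bigmax_leqP => j _.
    by have [qj _ _] := Hq j; apply: leq_trans (size_scale_leq _ _) qj.
  rewrite (leq_trans (qs P)) //= mulrC.
  by apply: leq_trans (size_polyMleq _ _) _; rewrite size_polyX addn2 ltnS qs.
- rewrite hornerD hornerN hornerM hornerX mul0r subr0 horner_sum.
  rewrite -[in RHS]Pv mxE; apply: eq_bigr => j _.
  by have [_ qj _] := Hq j; rewrite hornerZ qj.
- move=> d; rewrite /= mxE hornerD hornerN hornerM hornerX !horner_sum.
  rewrite mulr_sumr -sumrB; apply: eq_bigr => j _; have [_ _ qj] := Hq j.
  by rewrite !hornerZ qj !mxE; ring.
Qed.

Lemma pencil_spectral_radius n (P E : 'M[R]_n) (v : 'cV[R]_n) (m L r0 : R) :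
  let rho := (Num.sqrt L - Num.sqrt m) / (Num.sqrt L + Num.sqrt m) in
  0 < m -> m <= L -> P *m v = v -> v != 0 -> 0 <= r0 ->
  (forall d, m <= d <= L -> spectral_radius (P - d *: E) <= r0) -> rho <= r0.
Proof.
move=> rho m0 mL Pv v0 r00 Hr0; rewrite leNgt; apply/negP => r0rho.
(* The midpoint serves both ends: [r0 < r] permits the uniform power bound, and [rho <= r]
   contradicts [r0 < rho]. *)
pose r := (r0 + rho) / 2; suff : rho <= r by rewrite /r; lra.
have r0r : r0 < r by rewrite /r; lra.
have [i vi] : exists i, v i ord0 != 0.
  apply/existsP; apply: contraR v0; rewrite negb_exists => /forallP H.
  apply/eqP/matrixP => i j; rewrite ord1 mxE; apply/eqP.
  by have := H i; rewrite negbK.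
(* [B] dominates the entry sum of [P - d *: E] for all [d] in [[m, L]] at once, which makes [K]
   independent of [d]. *)
pose B := (\sum_i \sum_j `|P i j|) + L * \sum_i \sum_j `|E i j|.
pose K := power_const B r0 r n * (\sum_i `|v i ord0|) / (1 - rho).
have L0 : 0 < L by apply: lt_le_trans mL.
apply: (@le_geometric _ _ _ `|v i ord0| K 0); rewrite ?normr_gt0 //; [lra|lra|].
move=> t _; have [p [pt p0 pd]] := affine_pencil_poly E t i Pv.
rewrite -p0 /K mulrAC; apply: poly_at0_le => // d dmL; rewrite pd.
have le_sum j (F : 'I_n -> R) : `|F j| <= \sum_i `|F i|.
  by rewrite (bigD1 j) //= lerDl sumr_ge0.
apply: le_trans (le_sum i (fun j => iter t (mulmx (P - d *: E)) v j ord0)) _.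
rewrite mulrAC.
apply: (spectral_power_bound (r0 := r0)) => //; last exact: Hr0.
rewrite /B mulr_sumr -big_split; apply: ler_sum => j _ /=.
rewrite mulr_sumr -big_split; apply: ler_sum => j' _ /=.
rewrite !mxE; apply: le_trans (ler_normB _ _) _; rewrite lerD2l normrM.
case/andP: dmL => md dL; rewrite ler_wpM2r // ger0_norm //; lra.
Qed.

End Chebyshev.

(** * Gradient and minimizer of a quadratic function *)

Section Quadratics.
Variables (R : realType) (n : nat).
Implicit Types (Delta : 'M[R]_n) (x xs u v : 'cV[R]_n).

Definition quad Delta xs (f0 : R) x : R :=
  2^-1 * ((x - xs)^T *m Delta *m (x - xs)) ord0 ord0 + f0.

Lemma form_line Delta u v (h : R) : Delta^T = Delta ->
  ((u + h *: v)^T *m Delta *m (u + h *: v)) ord0 ord0 =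
  (u^T *m Delta *m u) ord0 ord0 + 2 * h * (v^T *m Delta *m u) ord0 ord0
  + h ^+ 2 * (v^T *m Delta *m v) ord0 ord0.
Proof.
(* A 1 by 1 matrix equals its transpose, so symmetry of [Delta] merges the two cross terms. *)
move=> sD; have uv : (u^T *m Delta *m v) ord0 ord0 = (v^T *m Delta *m u) ord0 ord0.
  rewrite -[in RHS](trmxK u) -[in RHS]sD -mulmxA -!trmx_mul [in RHS]mxE.
  by [].
have -> : (u + h *: v)^T = u^T + h *: v^T by rewrite linearD linearZ.
rewrite !mulmxDl !mulmxDr -!scalemxAl -!scalemxAr; move: uv.
move: (u^T *m _ *m u) (u^T *m _ *m v) (v^T *m _ *m u) (v^T *m _ *m v).
by move=> a b c d bc; rewrite !mxE bc; ring.
Qed.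

Lemma grad_quad Delta xs f0 x : Delta^T = Delta ->
  grad (quad Delta xs f0) x = Delta *m (x - xs).
Proof.
move=> sD; apply/matrixP => i j; rewrite ord1 mxE.
set v := delta_mx i ord0; set u := x - xs.
have vu : (Delta *m u) i ord0 = (v^T *m Delta *m u) ord0 ord0.
  by rewrite trmx_delta -mulmxA -rowE [RHS]mxE.
(* For [h != 0] the difference quotient is exactly affine in [h], with slope [c]. *)
pose c := 2^-1 * (v^T *m Delta *m v) ord0 ord0.
apply: cvg_lim => //.
apply: (@cvg_trans _ ((fun h : R => (Delta *m u) i ord0 + h * c) @ 0^')).
  apply: near_eq_cvg; near=> h.
  have h0 : h != 0 by near: h; exact: nbhs_dnbhs_neq.
  rewrite /= /quad.
  have -> : h *: v + x - xs = u + h *: v by rewrite -addrA addrC.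
  rewrite form_line // vu /c /GRing.scale /= -/u; by field.
have : (fun h : R => (Delta *m u) i ord0 + h * c) @ 0^'
    --> (Delta *m u) i ord0 + 0 * c.
  apply: cvgD; first exact: cvg_cst.
  by apply: cvgM; [exact: nbhs_dnbhs|exact: cvg_cst].
by rewrite mul0r addr0.
Unshelve. all: by end_near.
Qed.

(** As [Delta >= m I], the function exceeds [f0] by at least [m / 2] times the squared distance to
    [xs]. *)
Lemma minimizer_quad Delta (m L : R) xs f0 x : 0 < m -> hessians m L Delta ->
  minimizer (quad Delta xs f0) x <-> x = xs.
Proof.
move=> m0 [sD Dm _].
have low y : m * \sum_i (y - xs) i ord0 ^+ 2 <=
    ((y - xs)^T *m Delta *m (y - xs)) ord0 ord0.
  have := Dm (y - xs); move: (y - xs) => v.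
  rewrite mulmxBr mulmxBl mul_mx_scalar -scalemxAl.
  have -> : \sum_i v i ord0 ^+ 2 = (v^T *m v) ord0 ord0.
    by rewrite mxE; apply: eq_bigr => i _; rewrite mxE expr2.
  by move: (v^T *m _ *m v) (v^T *m v) => a b; rewrite !mxE subr_ge0.
have sq0 y : 0 <= \sum_i (y - xs) i ord0 ^+ 2.
  by apply: sumr_ge0 => i _; exact: sqr_ge0.
have fxs : quad Delta xs f0 xs = f0.
  by rewrite /quad subrr mulmx0 mxE mulr0 add0r.
split=> [/(_ xs)|-> y]; last first.
  rewrite fxs /quad lerDr mulr_ge0 ?invr_ge0 //.
  by apply: le_trans (low y); rewrite mulr_ge0 // ltW.
rewrite fxs /quad gerDr pmulr_rle0 ?invr_gt0 // => /(le_trans (low x)).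
rewrite pmulr_rle0 // => S0.
have /eqP : \sum_i (x - xs) i ord0 ^+ 2 = 0 by apply: le_anti; rewrite S0 sq0.
rewrite psumr_eq0 => [/allP z0|i _]; last exact: sqr_ge0.
apply/eqP; rewrite -subr_eq0; apply/eqP/matrixP => i j; rewrite ord1 [RHS]mxE.
by apply/eqP; rewrite -sqrf_eq0; apply: z0; rewrite mem_index_enum.
Qed.

End Quadratics.

(** * R-factors and geometric bounds *)

Section Rfactors.
Variables (R : realType) (n : nat).
Implicit Types (x : int -> 'cV[R]_n) (xs : 'cV[R]_n).

Lemma enorm_ge0 (v : 'cV[R]_n) : 0 <= enorm v.
Proof. exact: sqrtr_ge0. Qed.

Lemma coord_le_enorm (v : 'cV[R]_n) i : `|v i ord0| <= enorm v.
Proof.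
rewrite -sqrtr_sqr ler_sqrt ?sumr_ge0 // => [|j _]; last exact: sqr_ge0.
by rewrite (bigD1 i) //= lerDl sumr_ge0 // => j _; exact: sqr_ge0.
Qed.

Lemma enorm_le_sum (v : 'cV[R]_n) : enorm v <= \sum_i `|v i ord0|.
Proof.
have S0 : 0 <= \sum_i `|v i ord0| by exact: sumr_ge0.
rewrite -[leRHS](ger0_norm S0) -sqrtr_sqr ler_sqrt ?sqr_ge0 // expr2 mulr_suml.
apply: ler_sum => i _; rewrite -real_normK ?num_real // expr2 ler_wpM2l //.
by rewrite (bigD1 i) //= lerDl sumr_ge0.
Qed.

(** At [t = 0] the exponent [(t%:R)^-1] is 0 and the left power is 1, hence the condition
    [0 < t]. *)
Lemma root_le_expr (a r : R) (t : nat) : 0 <= a -> 0 <= r -> (0 < t)%N ->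
  (a `^ (t%:R)^-1 <= r) = (a <= r ^+ t).
Proof.
move=> a0 r0 t0; have t0R : t%:R != 0 :> R by rewrite pnatr_eq0 -lt0n.
apply/idP/idP => [H|H].
  have -> : a = (a `^ (t%:R)^-1) ^+ t.
    by rewrite -powR_mulrn ?powR_ge0 // -powRrM mulVf // powRr1.
  by rewrite lerXn2r // nnegrE // powR_ge0.
have -> : r = (r ^+ t) `^ (t%:R)^-1.
  by rewrite -powR_mulrn // -powRrM mulfV // powRr1.
by apply: ge0_ler_powR; rewrite ?invr_ge0 ?ler0n // nnegrE exprn_ge0.
Qed.

(** Passing from [r] to [r + e] absorbs the constant: [K (r / (r + e))^t] is eventually at most
    1. *)
Lemma Rfactor_seq_le x xs (K r : R) : 0 <= r ->
  (forall t : nat, enorm (x t%:Z - xs) <= K * r ^+ t) ->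
  (Rfactor_seq x xs <= r%:E)%E.
Proof.
move=> r0 H; apply/lee_addgt0Pr => e e0; rewrite -EFinD.
have re : 0 < r + e by lra.
have : (fun t => K * (r / (r + e)) ^+ t) @ \oo --> K * 0.
  apply: cvgM; first exact: cvg_cst.
  apply: cvg_expr.
  rewrite ger0_norm; last by rewrite divr_ge0 // ltW.
  by rewrite ltr_pdivrMr // mul1r; lra.
rewrite mulr0 => /cvgr_le /(_ 1 ltr01) [N _ HN].
apply: ge_ereal_inf.
exists (ereal_sup ((fun t : nat => (enorm (x t%:Z - xs) `^ (t%:R)^-1)%:E)
    @` [set t | (maxn N 1 <= t)%N])).
  by exists [set t | (maxn N 1 <= t)%N] => //; exists (maxn N 1).
apply: ge_ereal_sup => _ [t /= tN <-].
move: tN; rewrite geq_max => /andP[Nt t0].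
rewrite lee_fin root_le_expr ?enorm_ge0 ?(ltW re) //.
apply: le_trans (H t) _; have := HN t Nt; rewrite /= expr_div_n mulrA.
by rewrite ler_pdivrMr ?exprn_gt0 // mul1r.
Qed.

(** A strict bound on an infimum of tail suprema already holds on one tail; [0 <= r] because roots
    are nonnegative. *)
Lemma Rfactor_seq_lt x xs (r : R) : (Rfactor_seq x xs < r%:E)%E ->
  0 <= r /\ exists N, forall t : nat, (N <= t)%N -> enorm (x t%:Z - xs) <= r ^+ t.
Proof.
move=> /ereal_inf_lt[_ [V [N _ NV] <-]] supr.
have H (t : nat) : (N <= t)%N -> enorm (x t%:Z - xs) `^ (t%:R)^-1 <= r.
  move=> Nt; rewrite -lee_fin; apply: le_trans (ltW supr).
  by apply: ereal_sup_ubound; exists t => //; exact: NV.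
have r0 : 0 <= r by apply: le_trans (H N (leqnn N)); exact: powR_ge0.
split=> //; exists N.+1 => t Nt; rewrite -root_le_expr ?enorm_ge0 //.
  by apply: H; exact: ltnW.
exact: leq_trans Nt.
Qed.

End Rfactors.

(** * Block vectors and Kronecker products *)

Section Stack.
Variables (R : realType) (n : nat).

Definition stack a (e : nat -> 'cV[R]_n) : 'cV[R]_(a * n) :=
  \col_p e (mxtens_unindex p).1 (mxtens_unindex p).2 ord0.

Lemma eq_stack a (e e' : nat -> 'cV[R]_n) :
  stack a e = stack a e' <-> forall i, (i < a)%N -> e i = e' i.
Proof.
split=> [ee i ia|ee]; last first.
  by apply/matrixP => p j; rewrite !mxE ee.
apply/matrixP => s j; rewrite ord1.
have /matrixP/(_ (mxtens_index (Ordinal ia, s)) ord0) := ee.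
by rewrite !mxE mxtens_indexK.
Qed.

Lemma stackB a (e e' : nat -> 'cV[R]_n) :
  stack a (fun i => e i - e' i) = stack a e - stack a e'.
Proof. by apply/matrixP => p j; rewrite !mxE. Qed.

(** On block vectors [A *t D] mixes the blocks by [A] and applies [D] inside each. Taking the mixed
    blocks [g] as a parameter separates out the row sums of [A]. *)
Lemma tens_stack a b (A : 'M[R]_(a, b)) (D : 'M[R]_n) (e : nat -> 'cV[R]_n)
    (g : nat -> 'cV[R]_n) :
  (forall i : 'I_a, \sum_j A i j *: e j = g i) ->
  (A *t D) *m stack b e = stack a (fun i => D *m g i).
Proof.
move=> Ag; apply/matrixP => p j; rewrite !mxE; case: p / mxtens_indexP => i s.
rewrite mxtens_indexK /=.
transitivity (\sum_(i' < b) \sum_(s' < n) A i i' * D s s' * e i' s' ord0).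
  rewrite pair_big; rewrite (reindex (@mxtens_unindex b n)) /=; last first.
    by exists (@mxtens_index b n) => ? _; rewrite (mxtens_indexK, mxtens_unindexK).
  by apply: eq_bigr => q _; rewrite !mxE mxtens_indexK.
rewrite exchange_big; apply: eq_bigr => s' _ /=.
rewrite -Ag summxE mulr_sumr; apply: eq_bigr => i' _.
by rewrite mxE mulrCA mulrA.
Qed.

End Stack.

(** * The method as a linear recurrence for the error, and its R-factor *)

Section Method.
Variables (R : realType) (k l n : nat).
Variables (alpha : l.+1.-tuple R) (beta : k.-tuple R) (gamma : (k - l).+1.-tuple R).

(** Summation by parts trades the differences of coefficients in the last row for differences of
    iterates; the other rows are shifts. *)
Lemma A0_row_sum (V : lmodType R) (a : nat -> V) (i : 'I_k.+1) : (1 <= k)%N ->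
  \sum_(j < k.+1) A0 beta i j *: a j =
  if (i < k)%N then a i.+1
  else a k + \sum_(j < k) beta`_j *: (a (k - j)%N - a (k - j - 1)%N).
Proof.
move=> hk; case: ifPn => ik.
  have i1 : (i.+1 < k.+1)%N by [].
  rewrite (bigD1 (Ordinal i1)) //= big1 ?addr0 => [|j ji].
    by rewrite mxE ik eqxx scale1r.
  rewrite mxE ik; case: eqP => [jE|_]; last by rewrite scale0r.
  by case/eqP: ji; apply: val_inj.
(* The three cases of the last row in one formula, coefficients out of range being read as zero. *)
have coef (j : 'I_k.+1) : A0 beta i j =
    (if j == k :> nat then 1 else 0)
    + ((if (0 < j)%N then beta`_(k - j) else 0)
    - (if (j < k)%N then beta`_(k - j - 1) else 0)).
  rewrite mxE (negbTE ik); have := ltn_ord j; rewrite ltnS => jk.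
  case: (posnP j) => [->|j0].
    rewrite subn0 hk (_ : 0%N == k = false); last by case: k hk.
    by rewrite !add0r.
  have [->|jk'] := eqVneq (j : nat) k; first by rewrite subnn ltnn subr0.
  by rewrite add0r ltn_neqAle jk' jk.
under eq_bigr do rewrite coef scalerDl scalerBl.
rewrite big_split sumrB /=; congr (_ + _).
  rewrite big_ord_recr /= eqxx scale1r big1 ?add0r // => j _.
  by rewrite ltn_eqF ?scale0r.
rewrite big_ord_recl [X in _ - X]big_ord_recr /= ltnn !scale0r add0r addr0 -sumrB.
rewrite [RHS](reindex_inj rev_ord_inj) /=; apply: eq_bigr => j _.
have jk := ltn_ord j; rewrite /bump jk /= add1n -subnDA addn1 scalerBr.
by congr (_ *: a _ - _ *: a _); lia.
Qed.

Lemma B0_row_sum (V : lmodType R) (g : nat -> V) (i : 'I_k.+1) :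
  \sum_(r < l.+1) B0 alpha i r *: g r =
  if (i < k)%N then 0 else \sum_(j < l.+1) alpha`_j *: g (l - j)%N.
Proof.
case: ifPn => ik.
  by rewrite big1 // => r _; rewrite mxE ik scale0r.
rewrite [RHS](reindex_inj rev_ord_inj) /=; apply: eq_bigr => r _.
have rl := ltn_ord r; rewrite mxE (negbTE ik) subSS.
by congr (_ *: g _); lia.
Qed.

Lemma C0row_sum (V : lmodType R) (a : nat -> V) (j : nat) :
  (l <= k)%N -> (j <= l)%N ->
  \sum_(q < k.+1) C0row gamma j ord0 q *: a q =
  \sum_(nu < (k - l).+1) gamma`_nu *: a (k - j - nu)%N.
Proof.
move=> hlk jl; under eq_bigr do rewrite mxE.
rewrite -(big_mkord xpredT (fun q => (if (l - j <= q <= k - j)%N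
  then gamma`_(k - j - q) else 0) *: a q)).
(* The sum is cut to the support [l - j <= q <= k - j] of the row, then reversed by
   [q = k - j - nu]. *)
rewrite (@big_cat_nat _ _ _ (l - j)) //=; last by lia.
rewrite [X in X + _]big_nat_cond big1 ?add0r => [|q]; last first.
  by move=> /andP[/andP[_ q1] _]; rewrite leqNgt q1 scale0r.
rewrite (@big_cat_nat _ _ _ (k - j).+1) //=; [|lia|lia].
rewrite [X in _ + X]big_nat_cond [X in _ + X]big1 ?addr0 => [|q]; last first.
  by move=> /andP[/andP[q1 _] _]; rewrite [(q <= _)%N]leqNgt q1 andbF scale0r.
rewrite -{1}[(l - j)%N]add0n big_addn big_nat_rev /= add0n.
have -> : ((k - j).+1 - (l - j) = (k - l).+1)%N by lia.
rewrite big_mkord; apply: eq_bigr => nu _; have nukl := ltn_ord nu.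
rewrite ifT; last by apply/andP; split; lia.
by congr (gamma`_ _ *: a _); lia.
Qed.

Lemma Cmx_tens : Cmx gamma n =
  (\matrix_(r < l.+1, q < k.+1) C0row gamma (l - r) ord0 q) *t 1%:M.
Proof.
apply/matrixP => p q; rewrite [LHS]mxE /Cblock !mxE.
by rewrite mxtens_indexK.
Qed.

Hypotheses (hk : (1 <= k)%N) (hlk : (l <= k)%N).

(** [Abar] is a block companion matrix: it shifts the blocks and performs one linearized step of the
    method in the last. *)
Lemma Abar_stack (Delta : 'M[R]_n) (a : nat -> 'cV[R]_n) :
  Abar alpha beta gamma Delta *m stack k.+1 a = stack k.+1 (fun i =>
    if (i < k)%N then a i.+1 else
      a k + \sum_(j < k) beta`_j *: (a (k - j)%N - a (k - j - 1)%N)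
      - \sum_(j < l.+1) alpha`_j *:
          (Delta *m \sum_(nu < (k - l).+1) gamma`_nu *: a (k - j - nu)%N)).
Proof.
pose g r := \sum_(nu < (k - l).+1) gamma`_nu *: a (k - (l - r) - nu)%N.
pose h i := if (i < k)%N then a i.+1
  else a k + \sum_(j < k) beta`_j *: (a (k - j)%N - a (k - j - 1)%N).
pose h' i := if (i < k)%N then 0
  else \sum_(j < l.+1) alpha`_j *: (1%:M *m g (l - j)%N).
rewrite mulmxBl (@tens_stack _ _ _ _ _ _ a h) => [|i]; last exact: A0_row_sum.
rewrite -mulmxA Cmx_tens (@tens_stack _ _ _ _ _ _ a g); last first.
  move=> r; rewrite /g -C0row_sum ?leq_subr //.
  by apply: eq_bigr => q _; rewrite mxE.
rewrite (@tens_stack _ _ _ _ _ _ _ h') => [|i]; last first.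
  exact: (B0_row_sum (fun r => 1%:M *m g r)).
rewrite {}/h {}/h'.
rewrite -stackB; apply/eq_stack => i _; rewrite mul1mx; case: ifP => _.
  by rewrite mulmx0 subr0.
congr (_ - _).
rewrite mulmx_sumr; apply: eq_bigr => r _; have rl := ltn_ord r.
rewrite mul1mx -scalemxAr /g; congr (_ *: (_ *m _)).
by apply: eq_bigr => nu _; congr (_ *: a _); lia.
Qed.

Definition state (x : int -> 'cV[R]_n) (xs : 'cV[R]_n) (t : nat) :=
  stack k.+1 (fun i => x (t%:Z - k%:Z + i%:Z) - xs).

(** Only the last block carries the recurrence; in the others both sides agree by a shift of
    indices. *)
Lemma generated_quad (Delta : 'M[R]_n) (xs : 'cV[R]_n) (f0 : R) x :
  Delta^T = Delta -> \sum_(nu < (k - l).+1) gamma`_nu = 1 ->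
  generated alpha beta gamma (quad Delta xs f0) x <->
  forall t, state x xs t.+1 = Abar alpha beta gamma Delta *m state x xs t.
Proof.
move=> sD hgamma; rewrite /generated.
have step t : x t%:Z
      + \sum_(j < k) beta`_j *: (x (t%:Z - j%:Z) - x (t%:Z - j%:Z - 1))
      - \sum_(j < l.+1) alpha`_j *: grad (quad Delta xs f0)
          (\sum_(nu < (k - l).+1) gamma`_nu *: x (t%:Z - j%:Z - nu%:Z)) - xs =
    let a i := x (t%:Z - k%:Z + i%:Z) - xs in
    a k + \sum_(j < k) beta`_j *: (a (k - j)%N - a (k - j - 1)%N)
      - \sum_(j < l.+1) alpha`_j *:
          (Delta *m \sum_(nu < (k - l).+1) gamma`_nu *: a (k - j - nu)%N).
  set a := fun i : nat => _; rewrite addrAC; congr (_ - _).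
    rewrite addrAC; congr (_ + _); first by rewrite /a subrK.
    apply: eq_bigr => j _; have jk := ltn_ord j.
    rewrite /a opprB addrA subrK; congr (_ *: (x _ - x _)); lia.
  apply: eq_bigr => j _; have jl := ltn_ord j.
  rewrite grad_quad //; congr (_ *: (_ *m _)).
  (* As the [gamma] sum to 1, subtracting [xs] distributes over the average. *)
  rewrite -[X in _ - X]scale1r -hgamma scaler_suml -sumrB; apply: eq_bigr => nu _.
  have nukl := ltn_ord nu.
  by rewrite /a scalerBr; congr (_ *: x _ - _); lia.
split=> H t.
  rewrite Abar_stack; apply/eq_stack => i; rewrite ltnS => ik.
  case: ltnP => [ik'|ki]; first by congr (x _ - _); lia.
  have -> : i = k by apply/eqP; rewrite eqn_leq ik ki.
  by rewrite -[RHS]step -H; congr (x _ - _); lia.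
have := H t; rewrite Abar_stack => /eq_stack/(_ k (ltnSn k)); rewrite ltnn => Hk.
by have /addIr <- := etrans Hk (esym (step t)); congr (x _); lia.
Qed.

Lemma state_iter (Delta : 'M[R]_n) xs x :
  (forall t, state x xs t.+1 = Abar alpha beta gamma Delta *m state x xs t) ->
  forall t, state x xs t =
    iter t (mulmx (Abar alpha beta gamma Delta)) (state x xs 0).
Proof. by move=> H; elim=> // t IH; rewrite H IH. Qed.

(** Since [Abar] shifts blocks, block [i] of iterate [t] is block 0 of iterate [t + i]; the first
    blocks alone therefore define a trajectory. *)
Lemma trajectory_of_state (Delta : 'M[R]_n) xs (v : 'cV[R]_(k.+1 * n)) :
  exists x, forall t, state x xs t = iter t (mulmx (Abar alpha beta gamma Delta)) v.
Proof.
set A := Abar _ _ _ _.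
pose block t i : 'cV[R]_n :=
  \col_s (iter t (mulmx A) v) (mxtens_index (inord i, s)) ord0.
have blockE t : iter t (mulmx A) v = stack k.+1 (block t).
  apply/matrixP => p j; rewrite ord1; case: p / mxtens_indexP => i s.
  by rewrite !mxE mxtens_indexK /= inord_val.
have shift t i : (i <= k)%N -> block t i = block (t + i)%N 0%N.
  elim: i t => [|i IH] t ik; first by rewrite addn0.
  rewrite addnS -addSn -IH 1?ltnW //.
  have : A *m stack k.+1 (block t) = stack k.+1 (block t.+1) by rewrite -!blockE.
  by rewrite Abar_stack => /eq_stack/(_ i (ltnW ik)); rewrite ik.
exists (fun s : int => xs + block (absz (s + k%:Z)) 0%N) => t.
rewrite blockE; apply/eq_stack => i ik.
rewrite addrC addKr [RHS]shift //; congr (block _ _); lia.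
Qed.

(** The offset [k] puts all the times [t, ..., t + k] of the state past [N]. *)
Lemma coord_state_le xs x (r : R) (N t : nat) p :
  (forall s : nat, (N <= s)%N -> enorm (x s%:Z - xs) <= r ^+ s) -> 0 <= r ->
  (N <= t)%N ->
  `|state x xs (t + k) p ord0| <= r ^+ t * \sum_(i < k.+1) r ^+ i.
Proof.
move=> xr r0 Nt; case: p / mxtens_indexP => i s; rewrite mxE mxtens_indexK /=.
have -> : (t + k)%N%:Z - k%:Z + i%:Z = (t + i)%N by lia.
apply: le_trans (coord_le_enorm _ _) _.
apply: le_trans (xr _ (leq_trans Nt (leq_addr _ _))) _.
rewrite exprD ler_wpM2l ?exprn_ge0 //.
by rewrite (bigD1 i) //= lerDl sumr_ge0 // => j _; rewrite exprn_ge0.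
Qed.

Lemma Rfactor_quad (Delta : 'M[R]_n) (xs : 'cV[R]_n) (f0 : R) :
  (0 < n)%N -> Delta^T = Delta -> \sum_(nu < (k - l).+1) gamma`_nu = 1 ->
  (forall x, generated alpha beta gamma (quad Delta xs f0) x -> converges_to x xs) ->
  Rfactor alpha beta gamma (quad Delta xs f0) xs =
  (spectral_radius (Abar alpha beta gamma Delta))%:E.
Proof.
move=> n0 sD hgamma hconv; set A := Abar _ _ _ _.
have N0 : (0 < k.+1 * n)%N by rewrite muln_gt0.
have A0 := spectral_radius_ge0 A N0.
apply/eqP; rewrite eq_le; apply/andP; split.
  apply: ge_ereal_sup => _ [x [/(generated_quad _ _ _ sD hgamma) gx _] <-].
  have stx := state_iter gx.
  apply/lee_addgt0Pr => e e0; rewrite -EFinD.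
  pose r := spectral_radius A + e.
  have r0 : 0 < r by rewrite ltr_wpDl.
  pose K := power_const (\sum_i \sum_j `|A i j|) (spectral_radius A) r (k.+1 * n)
    * \sum_i `|state x xs 0 i ord0|.
  apply: (@Rfactor_seq_le _ _ _ _ K); first exact: ltW.
  move=> t.
  have coordE (s : 'I_n) : (x t%:Z - xs) s ord0 =
      state x xs t (mxtens_index (ord_max, s)) ord0.
    by rewrite [RHS]mxE mxtens_indexK /= subrK.
  apply: le_trans (enorm_le_sum _) _.
  apply: (@le_trans _ _ (\sum_p `|state x xs t p ord0|)).
    under eq_bigr do rewrite coordE.
    rewrite [leRHS](reindex (@mxtens_index k.+1 n)) /=; last first.
      exists (@mxtens_unindex k.+1 n) => ? _;
        by rewrite (mxtens_indexK, mxtens_unindexK).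
    pose F i s := `|state x xs t (mxtens_index (i, s)) ord0|.
    rewrite [leRHS](eq_bigr (fun q => F q.1 q.2)); last by case.
    rewrite -(pair_bigA _ F) /= /F.
    by rewrite (bigD1 ord_max) //= lerDl; do 2!apply: sumr_ge0 => ? _.
  rewrite stx mulrAC; apply: (spectral_power_bound (r0 := spectral_radius A)) => //.
  by rewrite ltrDl.
(* Comparison with every real [r] above the R-factor suffices: a finite value that is too small is
   refuted at a midpoint, [-oo] at [r = -1]. *)
suff H r : (Rfactor alpha beta gamma (quad Delta xs f0) xs < r%:E)%E ->
    spectral_radius A <= r.
  rewrite leNgt; apply/negP; case E : (Rfactor _ _ _ _ _) => [q||].
  - rewrite lte_fin => qA; have : spectral_radius A <= (q + spectral_radius A) / 2.
      by apply: H; rewrite E lte_fin; lra.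
    by rewrite leNgt; apply/negP; rewrite negbK; lra.
  - by [].
  - move=> _; have : spectral_radius A <= -1 by apply: H; rewrite E ltNyr.
    by rewrite leNgt; apply/negP; rewrite negbK; lra.
move=> Rr.
have traj (v : 'cV[R]_(k.+1 * n)) : 0 <= r /\ exists N, forall t p, (N <= t)%N ->
    `|iter (t + k) (mulmx A) v p ord0| <= r ^+ t * \sum_(i < k.+1) r ^+ i.
  have [x xv] := trajectory_of_state Delta xs v.
  have gx : generated alpha beta gamma (quad Delta xs f0) x.
    by apply/(generated_quad _ _ _ sD hgamma) => t; rewrite !xv.
  have : (Rfactor_seq x xs < r%:E)%E.
    apply: le_lt_trans Rr; apply: ereal_sup_ubound.
    by exists x => //; split=> //; exact: hconv.
  move=> /Rfactor_seq_lt[r0 [N HN]]; split=> //; exists N => t p Nt.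
  by rewrite -xv; exact: (coord_state_le _ HN).
apply: spectral_radius_le => // z /eigenvalue_col[w w0 Aw].
(* The zero vector serves only to extract [0 <= r], which settles [z = 0]. *)
have [r0 _] := traj 0.
have [-> |z0] := eqVneq z 0; first by rewrite normc0.
have [_ [Na HNa]] := traj (map_mx (@complex.Re R) w).
have [_ [Nb HNb]] := traj (map_mx (@complex.Im R) w).
have w1 : 0 < norm1 w.
  by rewrite lt_neqAle norm1_ge0 andbT; apply: contra w0 => /eqP/esym/norm1_eq0 ->.
have z1 : 0 < normc z.
  rewrite lt_neqAle normc_ge0 andbT; apply: contra z0 => /eqP/esym.
  by move=> /eq0_normc ->.
(* The power [normc z ^+ k] matches the bounds at time [t + k]; the factor 2 adds those for the real
   and imaginary parts. *)
apply: (@le_geometric _ _ _ (norm1 w * normc z ^+ k)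
  (\sum_(p < k.+1 * n) 2 * \sum_(i < k.+1) r ^+ i) (maxn Na Nb)) => //.
- exact: normc_ge0.
- by rewrite mulr_gt0 ?exprn_gt0.
move=> t; rewrite geq_max => /andP[tNa tNb].
have itw u : iter u (mulmx (map_mx (real_complex R) A)) w = z ^+ u *: w.
  elim: u => [|u IHu]; first by rewrite expr0 scale1r.
  by rewrite /= IHu -scalemxAr Aw scalerA exprSr.
(* [A] is real, so its powers act on real and imaginary parts separately. *)
have itc u p : iter u (mulmx (map_mx (real_complex R) A)) w p ord0 =
    Complex (iter u (mulmx A) (map_mx (@complex.Re R) w) p ord0)
      (iter u (mulmx A) (map_mx (@complex.Im R) w) p ord0).
  elim: u p => [|u IHu] p; first by rewrite /= !mxE; case: (w _ _).
  rewrite /= !mxE.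
  under eq_bigr do rewrite IHu mxE.
  apply/eqP; rewrite eq_complex /= !raddf_sum /=; apply/andP; split; apply/eqP.
    by apply: eq_bigr => q _ /=; rewrite mul0r subr0.
  by apply: eq_bigr => q _ /=; rewrite mul0r addr0.
have -> : norm1 w * normc z ^+ k * normc z ^+ t = norm1 (z ^+ (t + k) *: w).
  by rewrite norm1Z normcX exprD; ring.
rewrite -itw mulr_suml; apply: ler_sum => p _; rewrite itc.
move: (HNa t p tNa) (HNb t p tNb).
move: (iter _ _ (map_mx (@complex.Re R) w) p ord0).
move: (iter _ _ (map_mx (@complex.Im R) w) p ord0) => b a Ha Hb.
have -> : Complex a b = (a%:C)%C + Complex 0 b.
  by apply/eqP; rewrite eq_complex /= addr0 add0r !eqxx.
apply: le_trans (le_normcD _ _) _.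
have -> : normc (Complex 0 b) = `|b| by rewrite /= expr0n add0r sqrtr_sqr.
by rewrite normc_real; lra.
Qed.

End Method.

(** * Scalar Hessians and the two claims of the theorem *)

Lemma scalar_hessian (R : realType) n (m L d : R) :
  m <= d <= L -> hessians m L (d%:M : 'M[R]_n).
Proof.
have psd_scalar (c : R) : 0 <= c -> psd (c%:M : 'M[R]_n).
  move=> c0 v; rewrite mul_mx_scalar -scalemxAl mxE mulr_ge0 // mxE.
  by apply: sumr_ge0 => i _; rewrite mxE -expr2 sqr_ge0.
move=> /andP[md dL]; split; first exact: tr_scalar_mx.
  by rewrite -raddfB; apply: psd_scalar; rewrite subr_ge0.
by rewrite -raddfB; apply: psd_scalar; rewrite subr_ge0.
Qed.

Lemma Abar_scalar (R : realType) (k l n : nat) (alpha : l.+1.-tuple R)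
    (beta : k.-tuple R) (gamma : (k - l).+1.-tuple R) (d : R) :
  Abar alpha beta gamma (d%:M : 'M[R]_n) =
  A0 beta *t 1%:M - d *: ((B0 alpha *t 1%:M) *m Cmx gamma n).
Proof.
rewrite /Abar scalemxAl; congr (_ - mulmx _ _); apply/matrixP => i j.
by rewrite !mxE -[d *+ _]mulr_natr mulrCA.
Qed.

(** On a constant sequence the differences weighted by [beta] vanish and the shifts change
    nothing. *)
Lemma A0_stack_cst (R : realType) (k n : nat) (beta : k.-tuple R) (c : 'cV[R]_n) :
  (1 <= k)%N -> (A0 beta *t 1%:M) *m stack k.+1 (fun=> c) = stack k.+1 (fun=> c).
Proof.
move=> hk; rewrite (@tens_stack _ _ _ _ _ _ _ (fun=> c)) => [|i].
  by apply/eq_stack => i _; rewrite mul1mx.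
rewrite (A0_row_sum beta (fun=> c) i hk) subrr.
by under eq_bigr do rewrite scaler0; rewrite sumr_const mul0rn addr0; case: ifP.
Qed.

Theorem theorem1 (R : realType) (n : nat) (m L : R) (k l : nat)
    (alpha : l.+1.-tuple R) (beta : k.-tuple R) (gamma : (k - l).+1.-tuple R)
    (hn : (1 <= n)%N) (hm : 0 < m) (hmL : m <= L)
    (hk : (1 <= k)%N) (hlk : (l <= k)%N)
    (halpha : \sum_(j < l.+1) alpha`_j != 0)
    (hgamma : \sum_(nu < (k - l).+1) gamma`_nu = 1)
    (hconv : forall f : 'cV[R]_n -> R, quadratics m L f ->
               asymptotically_converges alpha beta gamma f) :
  let rho_star := (Num.sqrt L - Num.sqrt m) / (Num.sqrt L + Num.sqrt m) in
  let sup_rho := ereal_sup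
    [set (spectral_radius (Abar alpha beta gamma Delta))%:E
       | Delta in hessians m L : set 'M[R]_n] in
  ereal_sup [set r | exists (f : 'cV[R]_n -> R) (xs : 'cV[R]_n),
                       [/\ quadratics m L f, minimizer f xs
                         & r = Rfactor alpha beta gamma f xs]] = sup_rho
  /\ (rho_star%:E <= sup_rho)%E.
Proof.
move=> rho_star sup_rho; split.
  congr ereal_sup; apply/seteqP; split=> r.
    move=> [f [xs [qf min ->]]]; have [Delta [xs0 [f0 [HD fE]]]] := qf.
    have fE' : f = quad Delta xs0 f0 by rewrite fE.
    (* Uniqueness of the minimizer identifies [xs] with the centre of the quadratic. *)
    have xsE : xs = xs0 by apply/(minimizer_quad _ f0 _ hm HD); rewrite -fE'.
    have [sD _ _] := HD; exists Delta => //.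
    move: min qf; rewrite fE' xsE => min qf.
    by rewrite Rfactor_quad // => x gx; apply: hconv gx.
  move=> [Delta HD <-]; have [sD _ _] := HD.
  have min : minimizer (quad Delta 0 0) 0 by apply/(minimizer_quad _ _ _ hm HD).
  have qf : quadratics m L (quad Delta 0 0) by exists Delta, 0, 0.
  exists (quad Delta 0 0), 0; split=> //.
  by rewrite Rfactor_quad // => x gx; apply: hconv gx.
pose P := A0 beta *t (1%:M : 'M[R]_n).
pose E : 'M[R]_(k.+1 * n) := (B0 alpha *t 1%:M) *m Cmx gamma n.
have rho_le d : m <= d <= L -> ((spectral_radius (P - d *: E))%:E <= sup_rho)%E.
  move=> dmL; apply: ereal_sup_ubound; exists d%:M; first exact: scalar_hessian.
  by rewrite Abar_scalar.
have m_le : m <= m <= L by rewrite lexx.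
have N0 : (0 < k.+1 * n)%N by rewrite muln_gt0.
(* Only a finite supremum needs the pencil bound: [+oo] is immediate, and [d = m] excludes [-oo]. *)
case Esup : sup_rho rho_le => [q||] rho_le.
- rewrite lee_fin.
  apply: (@pencil_spectral_radius _ _ P E (stack k.+1 (fun=> const_mx 1)) m L) => //.
  + exact: A0_stack_cst.
  + apply/eqP => /matrixP/(_ (mxtens_index (ord0, Ordinal hn)) ord0).
    by rewrite !mxE => /eqP; rewrite oner_eq0.
  + apply: le_trans (spectral_radius_ge0 (P - m *: E) N0) _.
    by rewrite -lee_fin rho_le.
- exact: leey.
- by have := rho_le m m_le; rewrite leeNy_eq.
Qed.
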